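(* Let $J\subseteq\mathbb{R}$ be an open interval, let $\gamma\colon J\to\mathrm{AdS}$ be a null curve with bending $\kappa$, and let $(F_+,F_-)$ be the spinor frame field along it. A null curve $\widetilde\gamma\colon J\to\mathrm{AdS}$ is a $\mathcal{T}$-transform of $\gamma$ for $\chi=0$ if and only if $$\widetilde{\gamma}=\pm F_+\begin{pmatrix}\tanh(\xi)&-\operatorname{csch}(\xi)\operatorname{sech}(\xi)\,f\\0&\coth(\xi)\end{pmatrix}F_-^{-1}$$ (for one choice of the sign), where $\xi\neq0$ is a real constant and $f\colon J\to\mathbb{R}$ is a solution of the Riccati equation $$f'+f^2=\kappa+\cosh(2\xi).$$ Moreover, the bending of $\widetilde\gamma$ is $$\widetilde\kappa=-\kappa+2f^2-2\cosh(2\xi).$$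
   Context: Anti-de Sitter space. On the space $\mathbb{R}^{2,2}$ of real $2\times2$ matrices let $\langle\cdot,\cdot\rangle$ be the inner product of the quadratic form $X\mapsto-\det X$. $\mathrm{AdS}$ denotes $\mathrm{SL}(2,\mathbb{R})\subset\mathbb{R}^{2,2}$ with the induced Lorentzian metric. On $\Lambda^2(\mathbb{R}^{2,2})$ set $\langle\langle U\wedge V,W\wedge Z\rangle\rangle=\langle U,W\rangle\langle V,Z\rangle-\langle U,Z\rangle\langle V,W\rangle$. A null tangent vector $T\in T_X\mathrm{AdS}$ is future-directed if $\langle\langle I\wedge \mathsf{J},X\wedge T\rangle\rangle>0$, where $I$ is the identity matrix and $\mathsf{J}=\begin{pmatrix}0&1\\-1&0\end{pmatrix}$. Null curves. ''Null curve'' means a smooth immersed curve $\gamma\colon J\to\mathrm{AdS}$ ($J$ an open interval, prime $=d/ds$) with $\langle\gamma',\gamma'\rangle=0$, future-directed velocity, no inflection points ($\gamma'\wedge\gamma''\neq0$ everywhere), parameterized by proper time ($\langle\gamma'',\gamma''\rangle=4$). Its bending is $\kappa=-\frac1{16}\langle\gamma''',\gamma'''\rangle$. Spinor frame field. The spinor frame field along a null curve $\gamma$ with bending $\kappa$ is the smooth map $(F_+,F_-)\colon J\to\mathrm{SL}(2,\mathbb{R})\times\mathrm{SL}(2,\mathbb{R})$, defined up to a (common) sign, such that $\gamma=F_+F_-^{-1}$ and $$F_+'=F_+\begin{pmatrix}0&\kappa+1\\1&0\end{pmatrix},\qquad F_-'=F_-\begin{pmatrix}0&\kappa-1\\1&0\end{pmatrix}.$$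 All null curves are understood to come with such a spinor frame field. The pair of cousins $(\eta_+,\eta_-)$ associated with $\gamma$ consists of the first column vectors of $F_+$ and $F_-$; thus $F_\pm=(\eta_\pm,\eta_\pm')$ and $\det(\eta_\pm,\eta_\pm')=1$, i.e. $\eta_\pm\colon J\to\mathbb{R}^2\setminus\{(0,0)\}$ are star-shaped curves parameterized by central affine arc length. $\mathcal{T}$-transforms. Two star-shaped curves $\eta,\widetilde\eta\colon J\to\mathbb{R}^2\setminus\{(0,0)\}$ parameterized by central affine arc length (i.e. $\det(\eta,\eta')=\det(\widetilde\eta,\widetilde\eta')=1$) are $\mathcal{T}$-transforms of each other if $\det(\eta,\widetilde\eta)$ is a nonzero constant. Two null curves $\gamma,\widetilde\gamma\colon J\to\mathrm{AdS}$ with pairs of cousins $(\eta_+,\eta_-)$, $(\widetilde\eta_+,\widetilde\eta_-)$ are $\mathcal{T}$-transforms of each other if $\eta_+$ is a $\mathcal{T}$-transform of $\widetilde\eta_+$ and $\eta_-$ is a $\mathcal{T}$-transform of $\widetilde\eta_-$. A $\mathcal{T}$-transform $\widetilde\gamma$ of $\gamma$ is ''for $\chi=0$'' if, in addition, $$\det(\eta_+,\widetilde{\eta}_+)\,\det(\eta_-,\widetilde{\eta}_-')-\det(\eta_-,\widetilde{\eta}_-)\,\det(\eta_+,\widetilde{\eta}_+')=0\quad\text{on }J.$$ *)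

(* Defs.v *)
From HB Require Import structures.
From mathcomp Require Import all_boot all_order all_algebra.
From mathcomp Require Import all_classical all_reals all_analysis.

Set Implicit Arguments.
Unset Strict Implicit.
Unset Printing Implicit Defensive.

Import Order.TTheory GRing.Theory Num.Theory.
Import numFieldNormedType.Exports.

Local Open Scope classical_set_scope.
Local Open Scope ring_scope.

Section Hyperbolic.
Variable R : realType.
Implicit Type x : R.

Definition sinh x : R := (expR x - expR (- x)) / 2.
Definition cosh x : R := (expR x + expR (- x)) / 2.
Definition tanh x : R := sinh x / cosh x.
Definition coth x : R := cosh x / sinh x.
Definition csch x : R := (sinh x)^-1.
Definition sech x : R := (cosh x)^-1.

End Hyperbolic.

Section AntiDeSitter.
Variable R : realType.
Implicit Types (X Y U V W Z : 'M[R]_2).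

Definition mat2 (a b c d : R) : 'M[R]_2 :=
  \matrix_(i, j) if i == 0 then (if j == 0 then a else b)
                 else (if j == 0 then c else d).

Definition ads_quad X : R := - \det X.

Definition ads_ip X Y : R := (ads_quad (X + Y) - ads_quad X - ads_quad Y) / 2.

(* The exterior square is realized as the antisymmetric 2-tensors on
   the 4-dimensional space of 2 x 2 matrices; [mxvec] gives the coordinates. *)
Definition wedge U V : 'M[R]_(2 * 2) :=
  (mxvec U)^T *m mxvec V - (mxvec V)^T *m mxvec U.

(* The inner product of [U ^ V] and [W ^ Z], as a function of the four
   factors. *)
Definition wedge_ip U V W Z : R :=
  ads_ip U W * ads_ip V Z - ads_ip U Z * ads_ip V W.

Definition matJ : 'M[R]_2 := mat2 0 1 (- 1) 0.

Definition future_directed X (T : 'M[R]_2) : Prop :=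
  0 < wedge_ip 1%:M matJ X T.

End AntiDeSitter.

(* Curves on J are total functions on R of which only the restriction to J
   is relevant: J is open, so derivatives at points of J depend only on that
   restriction. *)
Section Curves.
Variable R : realType.
Implicit Types (J : set R) (gam : R -> 'M[R]_2) (eta : R -> 'cV[R]_2).

Definition open_interval J : Prop := open J /\ is_interval J.

Definition smooth_on (V : normedModType R) J (f : R -> V) : Prop :=
  forall (n : nat) s, J s -> derivable (derive1n n f) s 1.

Record null_curve J gam : Prop := NullCurve {
  null_curve_smooth : smooth_on J gam;
  null_curve_ads : forall s, J s -> \det (gam s) = 1;
  null_curve_immersed : forall s, J s -> derive1 gam s != 0;
  null_curve_null : forall s, J s -> ads_ip (derive1 gam s) (derive1 gam s) = 0;
  null_curve_future : forall s, J s -> future_directed (gam s) (derive1 gam s);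
  null_curve_noinfl : forall s, J s -> wedge (derive1 gam s) (derive1n 2 gam s) != 0;
  null_curve_proper : forall s, J s -> ads_ip (derive1n 2 gam s) (derive1n 2 gam s) = 4
}.

Definition bending gam (s : R) : R :=
  - (16^-1 * ads_ip (derive1n 3 gam s) (derive1n 3 gam s)).

Record spinor_frame J gam (Fp Fm : R -> 'M[R]_2) : Prop := SpinorFrame {
  spinor_smooth_p : smooth_on J Fp;
  spinor_smooth_m : smooth_on J Fm;
  spinor_det_p : forall s, J s -> \det (Fp s) = 1;
  spinor_det_m : forall s, J s -> \det (Fm s) = 1;
  spinor_curve : forall s, J s -> gam s = Fp s *m invmx (Fm s);
  spinor_deriv_p : forall s, J s ->
    derive1 Fp s = Fp s *m mat2 0 (bending gam s + 1) 1 0;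
  spinor_deriv_m : forall s, J s ->
    derive1 Fm s = Fm s *m mat2 0 (bending gam s - 1) 1 0
}.

Definition cousin (F : R -> 'M[R]_2) : R -> 'cV[R]_2 := fun s => col 0 (F s).

Definition det2 (u v : 'cV[R]_2) : R := \det (row_mx u v : 'M[R]_2).

(* Star-shaped curves parameterized by central affine arc length. *)
Record star_shaped J eta : Prop := StarShaped {
  star_shaped_smooth : smooth_on J eta;
  star_shaped_neq0 : forall s, J s -> eta s != 0;
  star_shaped_det : forall s, J s -> det2 (eta s) (derive1 eta s) = 1
}.

Definition star_T_transform J eta etat : Prop :=
  [/\ star_shaped J eta, star_shaped J etat &
      exists2 c : R, c != 0 & forall s, J s -> det2 (eta s) (etat s) = c].

(* The relations below are stated on spinor frame fields, i.e. on the pairs of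
   cousins; they are invariant under a common sign change of either frame
   field, which is the only freedom in its choice. *)
Definition frame_T_transform J (Fp Fm Fpt Fmt : R -> 'M[R]_2) : Prop :=
  star_T_transform J (cousin Fp) (cousin Fpt) /\
  star_T_transform J (cousin Fm) (cousin Fmt).

Definition frame_chi0 J (Fp Fm Fpt Fmt : R -> 'M[R]_2) : Prop :=
  forall s, J s ->
    det2 (cousin Fp s) (cousin Fpt s) * det2 (cousin Fm s) (derive1 (cousin Fmt) s)
    - det2 (cousin Fm s) (cousin Fmt s) * det2 (cousin Fp s) (derive1 (cousin Fpt) s)
    = 0.

Definition T_transform_chi0 J gam gamt : Prop :=
  exists Fp Fm Fpt Fmt : R -> 'M[R]_2,
    [/\ spinor_frame J gam Fp Fm, spinor_frame J gamt Fpt Fmt,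
        frame_T_transform J Fp Fm Fpt Fmt & frame_chi0 J Fp Fm Fpt Fmt].

Definition riccati_solution J (kappa : R -> R) (xi : R) (f : R -> R) : Prop :=
  forall s, J s ->
    derivable f s 1 /\ derive1 f s + f s ^+ 2 = kappa s + cosh (2 * xi).

Definition transform_curve (Fp Fm : R -> 'M[R]_2) (xi : R) (f : R -> R)
    (s : R) : 'M[R]_2 :=
  Fp s *m mat2 (tanh xi) (- (csch xi * sech xi * f s)) 0 (coth xi)
       *m invmx (Fm s).

Definition eq_up_to_sign_on J gam gamt : Prop :=
  (forall s, J s -> gamt s = gam s) \/ (forall s, J s -> gamt s = - gam s).

End Curves.

(* Main.v *)
Require Import Defs.
From HB Require Import structures.
From mathcomp Require Import all_boot all_order all_algebra.
From mathcomp Require Import all_classical all_reals all_analysis.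
From mathcomp Require Import ring lra.

(** Why the theorem holds.

    A frame F with [F' = F * mat2 0 q 1 0] and determinant 1 is the Wronskian
    matrix of a curve eta with [eta'' = q eta]; the frames [Fp] and [Fm] of a
    null curve are two of these, with potentials [kappa + 1] and [kappa - 1].
    For two such frames F and G, put [M = \adj F *m G], so that [G = F *m M].
    Its lower left entry is the determinant of the two cousins.

    If that entry is a constant c <> 0, then [\det M = 1] and the equation for
    the derivative of M leave one free function f = - M 0 0 / c: M is the matrix
    [backlund c f], and f solves [f' + f^2 = q + c^-2] ([backlund_of_hill]).
    Conversely, for such an f, [F *m backlund c f] is a frame for the potential
    [2 f^2 - q - 2 c^-2] ([hill_backlund]).

    Applied to both frames, with constants a and b, the condition chi = 0 says
    that the two functions f agree.  Equating their derivatives gives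
    [b^-2 - a^-2 = 2], which is the equation of a hyperbola and is parameterized
    by [2 sinh^2 xi = a^-2], [2 cosh^2 xi = b^-2].  The two Riccati equations
    then become the single one with [kappa + cosh (2 xi)], the two new potentials
    are [kt + 1] and [kt - 1] for the same
    [kt = - kappa + 2 f^2 - 2 cosh (2 xi)], and
    [backlund a f *m \adj (backlund b f)] is the triangular matrix of the
    theorem up to sign ([backlund_hyperbolic]).

    Two links to the null curves remain.  Differentiating
    [gam = Fp *m \adj Fm] three times shows that the k in the potentials
    [k + 1] and [k - 1] is the bending ([bending_frames]); this gives the formula
    for the bending of the transform and shows that the new frames form a
    spinor frame.  And the transform does not depend on the spinor frame
    chosen along gam, because [Fp *m X *m \adj Fm] with X upper triangular is
    a combination of gam and its first two derivatives ([frames_upper]). *)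

Set Implicit Arguments.
Unset Strict Implicit.
Unset Printing Implicit Defensive.

Import Order.TTheory GRing.Theory Num.Theory.
Import numFieldNormedType.Exports.

Local Open Scope classical_set_scope.
Local Open Scope ring_scope.

(** * Two by two matrices *)

Section Mat2.
Variable R : realType.
Implicit Types (a b c d : R) (M F G : 'M[R]_2).

Lemma mat2_eta M : M = mat2 (M 0 0) (M 0 1) (M 1 0) (M 1 1).
Proof.
apply/matrixP => i j; rewrite mxE.
by case: i => [[|[|//]] ?]; case: j => [[|[|//]] ?] /=; congr (M _ _); apply/val_inj.
Qed.

Lemma mul_mat2 a b c d a' b' c' d' :
  mat2 a b c d *m mat2 a' b' c' d' =
  mat2 (a * a' + b * c') (a * b' + b * d') (c * a' + d * c') (c * b' + d * d').
Proof.
by rewrite [LHS]mat2_eta !mxE !big_ord_recl !big_ord0 !mxE /= !addr0.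
Qed.

Lemma add_mat2 a b c d a' b' c' d' :
  mat2 a b c d + mat2 a' b' c' d' = mat2 (a + a') (b + b') (c + c') (d + d').
Proof. by rewrite [LHS]mat2_eta !mxE. Qed.

Lemma opp_mat2 a b c d : - mat2 a b c d = mat2 (- a) (- b) (- c) (- d).
Proof. by rewrite [LHS]mat2_eta !mxE. Qed.

Lemma scale_mat2 k a b c d :
  k *: mat2 a b c d = mat2 (k * a) (k * b) (k * c) (k * d).
Proof. by rewrite [LHS]mat2_eta !mxE. Qed.

Lemma mat2_scalar a : a%:M = mat2 a 0 0 a.
Proof. by rewrite [LHS]mat2_eta !mxE. Qed.

Lemma det_mx22 M : \det M = M 0 0 * M 1 1 - M 0 1 * M 1 0.
Proof.
rewrite (expand_det_row _ 0) !big_ord_recl big_ord0 /cofactor !det_mx11 !mxE/=.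
rewrite expr0 expr1 mul1r addr0 mulN1r mulrN.
by congr (M _ _ * M _ _ - M _ _ * M _ _); apply/val_inj.
Qed.

Lemma det_mat2 a b c d : \det (mat2 a b c d) = a * d - b * c.
Proof. by rewrite det_mx22 !mxE. Qed.

Lemma adj_mat2 a b c d : \adj (mat2 a b c d) = mat2 d (- b) (- c) a.
Proof.
rewrite [LHS]mat2_eta !mxE /cofactor !det_mx11 !mxE /=.
by rewrite expr0 !expr1 !mul1r -signr_odd /= !mulN1r !mul1r.
Qed.

Lemma adjugate_mulmx2 F G : \adj (F *m G) = \adj G *m \adj F.
Proof.
rewrite (mat2_eta F) (mat2_eta G) !(mul_mat2, adj_mat2).
by congr mat2; ring.
Qed.

Lemma det_adjugate2 F : \det (\adj F) = \det F.
Proof. by rewrite (mat2_eta F) adj_mat2 !det_mat2; ring. Qed.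

Lemma invmx_det1 F : \det F = 1 -> invmx F = \adj F.
Proof. by move=> dF; rewrite /invmx unitmxE dF unitr1 invr1 scale1r. Qed.

Lemma ads_ip_self F : ads_ip F F = - \det F.
Proof.
rewrite /ads_ip /ads_quad -mulr2n -scaler_nat detZ.
by field.
Qed.

Lemma det2_cols F G i j :
  det2 (col i F) (col j G) = F 0 i * G 1 j - G 0 j * F 1 i.
Proof.
have E1 (x : 'M[R]_(2, 1)) (y : 'M[R]_(2,1)) k : row_mx x y k 0 = x k 0.
  by rewrite -(row_mxEl x y); congr (_ _ _); apply/val_inj.
have E2 (x : 'M[R]_(2, 1)) (y : 'M[R]_(2,1)) k : row_mx x y k 1 = y k 0.
  by rewrite -(row_mxEr x y); congr (_ _ _); apply/val_inj.
by rewrite /det2 det_mx22 !E1 !E2 !mxE.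
Qed.

(** The determinants of the cousins of two frames are the bottom entries of the
    transition matrix between the frames. *)
Lemma det2_col00 F G : det2 (col 0 F) (col 0 G) = (\adj F *m G) 1 0.
Proof.
rewrite det2_cols [in RHS](mat2_eta F) [in RHS](mat2_eta G) adj_mat2 mul_mat2 mxE /=.
by ring.
Qed.

Lemma det2_col01 F G : det2 (col 0 F) (col 1 G) = (\adj F *m G) 1 1.
Proof.
rewrite det2_cols [in RHS](mat2_eta F) [in RHS](mat2_eta G) adj_mat2 mul_mat2 mxE /=.
by ring.
Qed.

End Mat2.

(** * Derivatives of matrix-valued functions *)

Section MatrixDerivative.
Variable R : realType.

Lemma is_derive_mxP m n (M : R -> 'M[R]_(m, n)) s v dM :
  is_derive s v M dM <->
  forall i j, is_derive s v (fun x => M x i j) (dM i j).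
Proof.
split=> [[Md <-] i j|h].
  split; first by move/derivable_mxP : Md; exact.
  by rewrite derive_mx// mxE.
have Md : derivable M s v by apply/derivable_mxP => i j; case: (h i j).
split=> //; rewrite derive_mx//.
by apply/matrixP => i j; rewrite mxE; case: (h i j).
Qed.

Lemma is_derive_mulmx m n p (A : R -> 'M[R]_(m, n)) (B : R -> 'M[R]_(n, p))
    s v dA dB :
  is_derive s v A dA -> is_derive s v B dB ->
  is_derive s v (fun x => A x *m B x) (dA *m B s + A s *m dB).
Proof.
move=> /is_derive_mxP hA /is_derive_mxP hB; apply/is_derive_mxP => i k.
have -> : (fun x => (A x *m B x) i k) =
    \sum_(j < n) ((fun x => A x i j) * (fun x => B x j k)).
  by apply/funext => x; rewrite mxE fct_sumE.
apply: is_derive_eq.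
rewrite !mxE -big_split/=; apply: eq_bigr => j _.
by rewrite addrC mulrC; congr (_ + _); rewrite mulrC.
Qed.

End MatrixDerivative.

(** * Smoothness on an open set *)

Section OpenDerivative.
Variables (R : realType) (J : set R).
Hypothesis J_open : open J.

Lemma near_eq_on (T : Type) (f g : R -> T) s :
  (forall x, J x -> f x = g x) -> J s -> \forall x \near s, f x = g x.
Proof.
move=> fg Js; have := open_nbhs_nbhs (conj J_open Js).
by apply: filterS => x; exact: fg.
Qed.

Lemma is_derive1E (V : normedModType R) (f : R -> V) (s : R) df :
  is_derive s 1 f df -> derive1 f s = df.
Proof. by move=> h; rewrite derive1E; case: h. Qed.

Lemma is_derive_on (V : normedModType R) (f g : R -> V) (s : R) df :
  (forall x, J x -> f x = g x) -> J s -> is_derive s 1 f df -> is_derive s 1 g df.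
Proof. by move=> fg Js; apply: near_eq_is_derive; exact: near_eq_on. Qed.

Lemma derive1_on (V : normedModType R) (f g : R -> V) s :
  (forall x, J x -> f x = g x) -> J s -> derive1 f s = derive1 g s.
Proof. by move=> fg Js; rewrite !derive1E; apply: near_eq_derive; exact: near_eq_on. Qed.

(** Bounding the order makes closure properties provable by induction on n,
    since the derivative lowers it by one. *)
Definition diff_on (V : normedModType R) (n : nat) (f : R -> V) : Prop :=
  forall k s, (k < n)%N -> J s -> derivable (derive1n k f) s 1.

Lemma smooth_onP (V : normedModType R) (f : R -> V) :
  smooth_on J f <-> forall n, diff_on n f.
Proof.
by split=> [h n k s _|h n s Js]; [exact: h|exact: (h n.+1)].
Qed.

Lemma diff_onW (V : normedModType R) n (f : R -> V) : diff_on n.+1 f -> diff_on n f.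
Proof. by move=> h k s kn; apply: h; rewrite ltnS ltnW. Qed.

Lemma diff_onS (V : normedModType R) n (f : R -> V) :
  diff_on n.+1 f <->
  (forall s, J s -> derivable f s 1) /\ diff_on n (derive1 f).
Proof.
split=> [h|[h0 h] [|k] s kn Js]; last 2 first.
- exact: h0.
- by rewrite derive1Sn; exact: h.
split=> [s Js|k s kn Js]; first exact: (h 0%N).
by rewrite -derive1Sn; exact: h.
Qed.

Lemma diff_on_eq (V : normedModType R) n (f g : R -> V) :
  (forall s, J s -> f s = g s) -> diff_on n f -> diff_on n g.
Proof.
elim: n f g => [|n IH] f g fg; first by move=> _ k s; rewrite ltn0.
move=> /diff_onS[fd f'd]; apply/diff_onS; split=> [s Js|].
  by apply: near_eq_derivable (fd s Js); exact: near_eq_on.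
by apply: IH f'd => s; exact: derive1_on.
Qed.

Lemma diff_on_is_derive (V : normedModType R) n (f g : R -> V) :
  (forall s, J s -> is_derive s 1 f (g s)) -> diff_on n g -> diff_on n.+1 f.
Proof.
move=> fg gd; apply/diff_onS; split=> [s Js|]; first by case: (fg s Js).
by apply: diff_on_eq gd => s Js; rewrite (is_derive1E (fg s Js)).
Qed.

Lemma diff_on_derive1 (V : normedModType R) n (f : R -> V) s :
  diff_on n.+1 f -> J s -> is_derive s 1 f (derive1 f s).
Proof.
by move=> h Js; rewrite derive1E; apply: derivableP; exact: (h 0%N).
Qed.

Lemma smooth_is_derive (V : normedModType R) (f : R -> V) s :
  smooth_on J f -> J s -> is_derive s 1 f (derive1 f s).
Proof. by move=> /smooth_onP/(_ 1%N); exact: diff_on_derive1. Qed.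

Lemma diff_on_cst (V : normedModType R) n (v : V) : diff_on n (fun=> v).
Proof.
elim: n v => [|n IH] v; first by move=> k s; rewrite ltn0.
by apply: (diff_on_is_derive (g := fun=> 0)) => // s _; exact: is_derive_cst.
Qed.

Lemma diff_onD (V : normedModType R) n (f g : R -> V) :
  diff_on n f -> diff_on n g -> diff_on n (fun s => f s + g s).
Proof.
elim: n f g => [|n IH] f g; first by move=> _ _ k s; rewrite ltn0.
move=> fd gd.
apply: (diff_on_is_derive (g := fun s => derive1 f s + derive1 g s)).
  by move=> s Js; apply: is_deriveD; [exact: diff_on_derive1 fd Js|
    exact: diff_on_derive1 gd Js].
by move/diff_onS : fd => [_ ?]; move/diff_onS : gd => [_ ?]; exact: IH.
Qed.

(** Any product with a Leibniz rule preserves differentiability to order n: the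
    derivative of the product is again a sum of two products.  Used for the
    product of scalars and for that of matrices. *)
Lemma diff_on_leibniz (U V W : normedModType R) (op : U -> V -> W) :
  (forall (f : R -> U) (g : R -> V) (s : R) df dg,
     is_derive s 1 f df -> is_derive s 1 g dg ->
     is_derive s 1 (fun x => op (f x) (g x)) (op df (g s) + op (f s) dg)) ->
  forall n f g, diff_on n f -> diff_on n g -> diff_on n (fun s => op (f s) (g s)).
Proof.
move=> opP; elim=> [|n IH] f g fd gd; first by move=> k s; rewrite ltn0.
apply: (diff_on_is_derive
  (g := fun s => op (derive1 f s) (g s) + op (f s) (derive1 g s))).
  by move=> s Js; apply: opP; [exact: diff_on_derive1 fd Js|
    exact: diff_on_derive1 gd Js].
have [_ f'd] := (diff_onS _ _).1 fd; have [_ g'd] := (diff_onS _ _).1 gd.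
by apply: diff_onD; apply: IH => //; exact: diff_onW.
Qed.

Lemma diff_on_mul n (f g : R -> R) :
  diff_on n f -> diff_on n g -> diff_on n (fun s => f s * g s).
Proof.
apply: (diff_on_leibniz (op := fun x y : R => x * y)).
move=> {}f {}g s df dg fd gd; apply: is_derive_eq.
by rewrite addrC /GRing.scale/= mulrC.
Qed.

Lemma diff_on_mulmx n p q r (A : R -> 'M[R]_(p, q)) (B : R -> 'M[R]_(q, r)) :
  diff_on n A -> diff_on n B -> diff_on n (fun s => A s *m B s).
Proof.
apply: (diff_on_leibniz (op := fun (A : 'M[R]_(p, q)) (B : 'M[R]_(q, r)) => A *m B)).
by move=> *; exact: is_derive_mulmx.
Qed.

Lemma diff_on_mxP n p q (M : R -> 'M[R]_(p, q)) :
  diff_on n M <-> forall i j, diff_on n (fun s => M s i j).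
Proof.
elim: n M => [|n IH] M; first by split=> [_ i j|_] k s; rewrite ltn0.
split=> [Md i j|Md].
  apply: (diff_on_is_derive (g := fun s => derive1 M s i j)) => [s Js|].
    exact: ((is_derive_mxP _ _ _ _).1 (diff_on_derive1 Md Js)).
  by have [_ /IH] := (diff_onS _ _).1 Md; exact.
apply: (diff_on_is_derive (g := fun s => \matrix_(i, j) derive1 (fun s => M s i j) s)).
  move=> s Js; apply/is_derive_mxP => i j; rewrite mxE.
  exact: diff_on_derive1 (Md i j) Js.
apply/IH => i j; case/diff_onS : (Md i j) => _; apply: diff_on_eq => s _.
by rewrite mxE.
Qed.

Lemma diff_on_mat2 n (a b c d : R -> R) :
  diff_on n a -> diff_on n b -> diff_on n c -> diff_on n d ->
  diff_on n (fun s => mat2 (a s) (b s) (c s) (d s)).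
Proof.
move=> ad bd cd dd; apply/diff_on_mxP.
move=> i j.
apply: (@diff_on_eq _ _ (if i == 0 then (if j == 0 then a else b)
                                   else (if j == 0 then c else d))) => [s _|].
  by rewrite mxE; do 2 case: ifP.
by do 2 case: ifP.
Qed.

(** Bootstrap: the equation expresses f' through f, so each order of
    differentiability of f yields the next one. *)
Lemma smooth_riccati (q f : R -> R) :
  smooth_on J q ->
  (forall s, J s -> is_derive s 1 f (q s - f s ^+ 2)) -> smooth_on J f.
Proof.
move=> /smooth_onP qd fd; apply/smooth_onP; elim=> [|n IH].
  by move=> k s; rewrite ltn0.
apply: (diff_on_is_derive fd).
apply: (diff_on_eq (f := fun s => q s + (-1) * (f s * f s))) => [s _|].
  by rewrite mulN1r expr2.
apply: (diff_onD (f := q) (g := fun s => -1 * (f s * f s)) (qd n)).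
apply: (diff_on_mul (f := fun=> -1)); first exact: diff_on_cst.
exact: diff_on_mul.
Qed.

Lemma smooth_derive1n (V : normedModType R) n (f : R -> V) :
  smooth_on J f -> smooth_on J (derive1n n f).
Proof.
move=> h k s Js; have -> : derive1n k (derive1n n f) = derive1n (k + n) f.
  by rewrite /derive1n iterD.
exact: h.
Qed.

Lemma smooth_bending (gam : R -> 'M[R]_2) :
  smooth_on J gam -> smooth_on J (bending gam).
Proof.
move=> /(@smooth_derive1n _ 3)/smooth_onP h; apply/smooth_onP => n.
have hij i j : diff_on n (fun s => derive1n 3 gam s i j).
  by move: i j; apply/diff_on_mxP.
set t := derive1n 3 gam in hij.
apply: (diff_on_eq (f := fun s =>
  16^-1 * (t s 0 0 * t s 1 1 + (-1) * (t s 0 1 * t s 1 0)))) => [s _|].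
  by rewrite /bending -/t ads_ip_self det_mx22; ring.
apply: diff_on_mul; first exact: diff_on_cst.
apply: diff_onD; first exact: diff_on_mul.
by apply: diff_on_mul; [exact: diff_on_cst|exact: diff_on_mul].
Qed.

End OpenDerivative.

(** * Hyperbolic functions *)

Section HyperbolicFunctions.
Variable R : realType.
Implicit Types x S C : R.

Lemma cosh_gt0 x : 0 < cosh x.
Proof. by rewrite divr_gt0// addr_gt0// expR_gt0. Qed.

Lemma cosh2Bsinh2 x : cosh x ^+ 2 - sinh x ^+ 2 = 1.
Proof.
have e : expR x * expR (- x) = 1 by rewrite expRxMexpNx_1.
rewrite /cosh /sinh -[RHS]e; by field.
Qed.

Lemma cosh_double x : cosh (2 * x) = 1 + 2 * sinh x ^+ 2.
Proof.
have e : expR x * expR (- x) = 1 by rewrite expRxMexpNx_1.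
rewrite /cosh /sinh -mulrN !expRM_natl -[X in _ = X + _]e.
by field.
Qed.

Lemma sinh_eq0 x : (sinh x == 0) = (x == 0).
Proof.
rewrite /sinh mulf_eq0 invr_eq0 pnatr_eq0 orbF subr_eq0 (inj_eq (@expR_inj R)).
by rewrite -addr_eq0 -mulr2n mulrn_eq0.
Qed.

(** The parameter is ln (C + S), because (C + S) (C - S) = 1 makes C - S the
    inverse of exp x. *)
Lemma hyperbola_param S C : 0 < C -> C ^+ 2 - S ^+ 2 = 1 ->
  exists x, sinh x = S /\ cosh x = C.
Proof.
move=> C0 CS; have e0 : 0 < C + S.
  have /pmulr_lgt0 <- : 0 < C - S by nra.
  by rewrite mulrC -subr_sqr CS.
have eN : expR (- ln (C + S)) = C - S.
  rewrite expRN lnK//.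
  apply: (mulfI (lt0r_neq0 e0)); rewrite divff ?lt0r_neq0//.
  by rewrite mulrC -subr_sqr CS.
exists (ln (C + S)); rewrite /sinh /cosh eN lnK//.
by split; field.
Qed.

End HyperbolicFunctions.

(** * Frames of Hill's equation and the null curves they span *)

Section SpinorFrames.
Variables (R : realType) (J : set R).
Hypothesis J_open : open J.
Implicit Types (F G : R -> 'M[R]_2) (X : 'M[R]_2) (q k f : R -> R).

(** The rows of F are Wronskian pairs (y, y') of solutions of Hill's equation
    y'' = q y. *)
Definition hill_frame q F : Prop :=
  forall s, J s -> \det (F s) = 1 /\ is_derive s 1 F (F s *m mat2 0 (q s) 1 0).

Lemma is_derive_adjugate F (s : R) dF :
  is_derive s 1 F dF -> is_derive s 1 (fun x => \adj (F x)) (\adj dF).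
Proof.
move=> /is_derive_mxP Fd; apply/is_derive_mxP.
have h i j : is_derive s 1 (fun x => - F x i j) (- dF i j) by apply: is_deriveN.
have E M : \adj M = mat2 (M 1 1) (- M 0 1) (- M 1 0) (M 0 0) :> 'M[R]_2.
  by rewrite [in LHS](mat2_eta M) adj_mat2.
move=> i j; rewrite E.
have -> : (fun x => (\adj (F x)) i j) =
    (if i == 0 then (if j == 0 then (fun x => F x 1 1) else (fun x => - F x 0 1))
     else (if j == 0 then (fun x => - F x 1 0) else (fun x => F x 0 0))).
  by apply/funext => x; rewrite E mxE; do 2 case: ifP.
by rewrite mxE; do 2 case: ifP => _.
Qed.

(** Since [mat2 0 q 1 0] has trace 0, its adjugate is its opposite; hence
    [\adj Fm] solves the equation of the inverse frame and differentiation acts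
    on the middle factor as a twisted commutator. *)
Lemma is_derive_frame_conj qp qm Fp Fm X (s : R) :
  hill_frame qp Fp -> hill_frame qm Fm -> J s ->
  is_derive s 1 (fun x => Fp x *m X *m \adj (Fm x))
    (Fp s *m (mat2 0 (qp s) 1 0 *m X - X *m mat2 0 (qm s) 1 0) *m \adj (Fm s)).
Proof.
move=> hp hm Js; have [_ dp] := hp s Js; have [_ dm] := hm s Js.
have dX : is_derive s 1 (fun=> X) 0 by exact: is_derive_cst.
have dpX := is_derive_mulmx dp dX.
apply: is_derive_eq (is_derive_mulmx dpX (is_derive_adjugate dm)) _.
have adjA x : \adj (mat2 0 x 1 0) = - mat2 0 x 1 0 :> 'M[R]_2.
  by rewrite adj_mat2 opp_mat2 oppr0.
by rewrite mulmx0 addr0 adjugate_mulmx2 adjA mulNmx mulmxN mulmxBr mulmxBl !mulmxA.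
Qed.

Lemma spinor_hill gam Fp Fm : spinor_frame J gam Fp Fm ->
  hill_frame (fun s => bending gam s + 1) Fp /\
  hill_frame (fun s => bending gam s - 1) Fm.
Proof.
move=> h; split=> s Js; split.
- exact: spinor_det_p h s Js.
- rewrite -(spinor_deriv_p h Js).
  exact: smooth_is_derive (spinor_smooth_p h) Js.
- exact: spinor_det_m h s Js.
- rewrite -(spinor_deriv_m h Js).
  exact: smooth_is_derive (spinor_smooth_m h) Js.
Qed.

Lemma spinor_curve_adj gam Fp Fm s : spinor_frame J gam Fp Fm -> J s ->
  gam s = Fp s *m \adj (Fm s).
Proof.
move=> h Js; rewrite (spinor_curve h Js) invmx_det1//; exact: spinor_det_m h s Js.
Qed.

Section CurveOfFrames.
Variables (k : R -> R) (Fp Fm gam : R -> 'M[R]_2).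
Hypotheses (hp : hill_frame (fun s => k s + 1) Fp)
           (hm : hill_frame (fun s => k s - 1) Fm)
           (gamE : forall s, J s -> gam s = Fp s *m \adj (Fm s)).

Lemma derive1_frames s : J s ->
  derive1 gam s = Fp s *m mat2 0 2 0 0 *m \adj (Fm s).
Proof.
move=> Js; rewrite (@derive1_on _ _ J_open _ _ (fun x => Fp x *m 1%:M *m \adj (Fm x)) _ _ Js).
  rewrite (is_derive1E (is_derive_frame_conj _ hp hm Js)).
  rewrite mul1mx mulmx1 opp_mat2 add_mat2; congr (_ *m mat2 _ _ _ _ *m _); ring.
by move=> x /gamE ->; rewrite mulmx1.
Qed.

Lemma derive1n2_frames s : J s ->
  derive1n 2 gam s = Fp s *m mat2 (-2) 0 0 2 *m \adj (Fm s).
Proof.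
move=> Js; rewrite derive1nS (derive1_on J_open derive1_frames Js).
rewrite (is_derive1E (is_derive_frame_conj _ hp hm Js)).
by rewrite !mul_mat2 opp_mat2 add_mat2; congr (_ *m mat2 _ _ _ _ *m _); ring.
Qed.

Lemma derive1n3_frames s : J s ->
  derive1n 3 gam s = Fp s *m mat2 0 (4 * k s) (-4) 0 *m \adj (Fm s).
Proof.
move=> Js; rewrite derive1nS (derive1_on J_open derive1n2_frames Js).
rewrite (is_derive1E (is_derive_frame_conj _ hp hm Js)).
by rewrite !mul_mat2 opp_mat2 add_mat2; congr (_ *m mat2 _ _ _ _ *m _); ring.
Qed.

(** The third derivative has determinant 16 k, as the frames have determinant 1. *)
Lemma bending_frames s : J s -> bending gam s = k s.
Proof.
move=> Js; rewrite /bending derive1n3_frames// ads_ip_self !det_mulmx.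
rewrite det_adjugate2 (hp Js).1 (hm Js).1 det_mat2.
by field.
Qed.

(** The middle factors of gam, gam' and gam'' are a basis of the upper triangular
    matrices. *)
Lemma frames_upper a b d s : J s ->
  Fp s *m mat2 a b 0 d *m \adj (Fm s) =
  ((a + d) / 2) *: gam s + (b / 2) *: derive1 gam s
  + ((d - a) / 4) *: derive1n 2 gam s.
Proof.
move=> Js; rewrite gamE// derive1_frames// derive1n2_frames//.
have -> : mat2 a b 0 d = ((a + d) / 2) *: 1%:M + (b / 2) *: mat2 0 2 0 0
    + ((d - a) / 4) *: mat2 (-2) 0 0 2.
  rewrite mat2_scalar !scale_mat2 !add_mat2.
  by congr mat2; field.
by rewrite !(mulmxDr, mulmxDl) -!(scalemxAr, scalemxAl) mulmx1.
Qed.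


End CurveOfFrames.
End SpinorFrames.

(** * The Backlund matrix *)

Section BacklundMatrix.
Variable R : realType.
Implicit Types (a b c f xi tau : R).

(** The first column says that the new curve is [- c f eta + c eta']; the second
    column is then the derivative of that curve, simplified by means of the
    Riccati equation for f. *)
Definition backlund c f : 'M[R]_2 := mat2 (- (c * f)) (c * f ^+ 2 - c^-1) c (- (c * f)).

Lemma det_backlund c f : c != 0 -> \det (backlund c f) = 1.
Proof. by move=> c0; rewrite det_mat2; field. Qed.

Lemma backlund_quotient a b f : a != 0 -> b != 0 ->
  backlund a f *m \adj (backlund b f) =
  mat2 (b / a) (f * (b / a - a / b)) 0 (a / b).
Proof.
move=> a0 b0; rewrite adj_mat2 mul_mat2; congr mat2; field => //.
by rewrite a0 b0.
Qed.

(** The constant determinants of the pairs of cousins; the sign tau in the second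
    one becomes the sign of the transformed curve. *)
Definition amplitude_p xi : R := (Num.sqrt 2 * sinh xi)^-1.
Definition amplitude_m tau xi : R := tau / (Num.sqrt 2 * cosh xi).

Lemma sqrt2_sqr : Num.sqrt 2 ^+ 2 = 2 :> R.
Proof. by rewrite sqr_sqrtr. Qed.

Lemma sqrt2_neq0 : Num.sqrt 2 != 0 :> R.
Proof. by rewrite lt0r_neq0// sqrtr_gt0. Qed.

Lemma cosh_neq0 xi : cosh xi != 0.
Proof. by rewrite lt0r_neq0// cosh_gt0. Qed.

Lemma amplitude_p_neq0 xi : xi != 0 -> amplitude_p xi != 0.
Proof. by move=> xi0; rewrite invr_neq0// mulf_neq0 ?sqrt2_neq0 ?sinh_eq0. Qed.

Lemma amplitude_m_neq0 tau xi : tau != 0 -> amplitude_m tau xi != 0.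
Proof. by move=> t0; rewrite mulf_neq0// invr_neq0// mulf_neq0 ?sqrt2_neq0 ?cosh_neq0. Qed.

Lemma amplitude_p_sqr xi : amplitude_p xi ^- 2 = cosh (2 * xi) - 1.
Proof. by rewrite exprVn invrK exprMn sqrt2_sqr cosh_double; ring. Qed.

Lemma amplitude_m_sqr tau xi : tau ^+ 2 = 1 ->
  amplitude_m tau xi ^- 2 = cosh (2 * xi) + 1.
Proof.
move=> t1; rewrite exprMn exprVn t1 mul1r invrK exprMn sqrt2_sqr cosh_double.
have := cosh2Bsinh2 xi; lra.
Qed.

Lemma backlund_hyperbolic tau xi f : xi != 0 -> tau ^+ 2 = 1 ->
  backlund (amplitude_p xi) f *m \adj (backlund (amplitude_m tau xi) f) =
  tau *: mat2 (tanh xi) (- (csch xi * sech xi * f)) 0 (coth xi).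
Proof.
move=> xi0 t1; have t0 : tau != 0 by rewrite -sqrf_eq0 t1 oner_neq0.
rewrite backlund_quotient ?amplitude_p_neq0 ?amplitude_m_neq0//.
rewrite scale_mat2 /amplitude_p /amplitude_m /tanh /coth /csch /sech.
have r0 := sqrt2_neq0; have c0 := cosh_neq0 xi.
have s0 : sinh xi != 0 by rewrite sinh_eq0.
have tV : tau^-1 = tau by rewrite -[RHS]divr1 -t1; field.
have ch : cosh xi ^+ 2 = 1 + sinh xi ^+ 2 by rewrite -(cosh2Bsinh2 xi); ring.
congr mat2.
- by field; rewrite s0 c0.
- transitivity (tau * f * ((sinh xi ^+ 2 - cosh xi ^+ 2) / (sinh xi * cosh xi))).
    by rewrite invf_div tV; field; rewrite s0 c0 r0.
  by rewrite ch; field; rewrite s0 c0.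
- by rewrite mulr0.
- by rewrite invf_div tV; field; rewrite s0 r0.
Qed.

End BacklundMatrix.

(** * Backlund transformations of Hill's equation *)

Section Backlund.
Variables (R : realType) (J : set R).
Hypothesis J_open : open J.
Implicit Types (F G : R -> 'M[R]_2) (q f : R -> R).

(** With [F' = F A] and At the matrix of the new potential, the claim is the gauge
    identity [A B + B' = B At] for [B = backlund c f], which follows from the Riccati
    equation. *)
Lemma hill_backlund c q f F : c != 0 -> hill_frame J q F ->
  (forall s, J s -> is_derive s 1 f (q s + c ^- 2 - f s ^+ 2)) ->
  hill_frame J (fun s => 2 * f s ^+ 2 - q s - 2 * c ^- 2)
    (fun s => F s *m backlund c (f s)).
Proof.
move=> c0 Fq fd s Js; have [dF Fd] := Fq s Js; split.
  by rewrite det_mulmx dF det_backlund// mul1r.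
set f' := q s + c ^- 2 - f s ^+ 2.
have fs := fd s Js; rewrite -/f' in fs.
have Bd : is_derive s 1 (fun x => backlund c (f x))
    (mat2 (- (c * f')) (2 * c * f s * f') 0 (- (c * f'))).
  have d1 : is_derive s 1 (fun x => - (c * f x)) (- (c * f')).
    by apply: is_deriveN; apply: is_deriveZ.
  have d2 : is_derive s 1 (fun x => c * f x ^+ 2 - c^-1) (2 * c * f s * f').
    have d3 : is_derive s 1 (fun x => f x ^+ 2) (2 * f s * f').
      have ff : is_derive s 1 (f * f) (f s * f' + f s * f') by exact: is_deriveM.
      by apply: is_derive_eq ff _; ring.
    have d4 : is_derive s 1 (fun x => c * f x ^+ 2) (c * (2 * f s * f')).
      exact: is_deriveZ.
    have d5 : is_derive s 1 (fun=> c^-1) 0 by exact: is_derive_cst.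
    have d6 : is_derive s 1 (fun x => c * f x ^+ 2 - c^-1) (c * (2 * f s * f') - 0).
      exact: is_deriveB.
    by apply: is_derive_eq d6 _; ring.
  have d0 : is_derive s 1 (fun=> c) 0 by exact: is_derive_cst.
  apply/is_derive_mxP.
  case=> [[|[|//]] ?] [[|[|//]] ?]; rewrite mxE/=;
    [move: d1|move: d2|move: d0|move: d1];
    apply: near_eq_is_derive; near=> x; rewrite mxE//.
apply: is_derive_eq (is_derive_mulmx Fd Bd) _.
rewrite -!mulmxA -mulmxDr !mul_mat2 add_mat2; congr (_ *m _).
by congr mat2; rewrite /f'; field.
Unshelve. all: by end_near. Qed.

(** The transition matrix [M = \adj F *m G] satisfies [M' = M At - A M]
    when [F' = F A] and [G' = G At].  Its lower left entry c is constant, so the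
    corresponding entry of this equation gives M 1 1 = M 0 0; the determinant
    then fixes M 0 1, and the upper left entry is the Riccati equation. *)
Lemma backlund_of_hill c q qt F G : c != 0 ->
  hill_frame J q F -> hill_frame J qt G ->
  (forall s, J s -> (\adj (F s) *m G s) 1 0 = c) ->
  exists f : R -> R, forall s, J s ->
    is_derive s 1 f (q s + c ^- 2 - f s ^+ 2) /\ G s = F s *m backlund c (f s).
Proof.
move=> c0 Fq Gq cE; pose M s := \adj (F s) *m G s.
have Md s : J s -> is_derive s 1 M
    (mat2 (- (q s * M s 1 0) + M s 0 1) (- (q s * M s 1 1) + M s 0 0 * qt s)
       (- M s 0 0 + M s 1 1) (- M s 0 1 + M s 1 0 * qt s)).
  move=> Js; have [_ Fd] := Fq s Js; have [_ Gd] := Gq s Js.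
  apply: is_derive_eq (is_derive_mulmx (is_derive_adjugate Fd) Gd) _.
  rewrite adjugate_mulmx2 -[X in X + _]mulmxA [X in _ + X]mulmxA -/(M s).
  rewrite [in LHS](mat2_eta (M s)).
  by rewrite adj_mat2 !mul_mat2 add_mat2; congr mat2; ring.
have M11 s : J s -> M s 1 1 = M s 0 0.
  move=> Js; have d0 : is_derive s 1 (fun x => M x 1 0) 0.
    apply: (is_derive_on J_open _ Js (is_derive_cst c s 1)) => x Jx.
    by rewrite /M cE.
  have d1 := (is_derive_mxP _ _ _ _).1 (Md s Js) 1 0.
  have := is_derive1E d1; rewrite (is_derive1E d0) mxE/=.
  by move/eqP; rewrite eq_sym addrC subr_eq0 => /eqP.
have detM s : J s -> M s 0 0 ^+ 2 - M s 0 1 * c = 1.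
  move=> Js; have : \det (M s) = 1.
    by rewrite /M det_mulmx det_adjugate2 (Fq s Js).1 (Gq s Js).1 mul1r.
  by rewrite det_mx22 M11// [M s 1 0]cE// expr2.
exists (fun s => - c^-1 * M s 0 0) => s Js; split.
  have d0 := (is_derive_mxP _ _ _ _).1 (Md s Js) 0 0.
  rewrite mxE/= [M s 1 0]cE// in d0.
  have d1 : is_derive s 1 (fun x => - c^-1 * M x 0 0) (- c^-1 * (- (q s * c) + M s 0 1)).
    exact: is_deriveZ.
  apply: is_derive_eq d1 _.
  have -> : M s 0 1 = (M s 0 0 ^+ 2 - 1) / c.
    by rewrite -(detM s Js); field.
  by field.
have -> : G s = F s *m M s.
  by rewrite mulmxA mul_mx_adj (Fq s Js).1 mul1mx.
congr (_ *m _); rewrite [LHS]mat2_eta M11// [M s 1 0]cE// /backlund.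
have -> : M s 0 1 = (M s 0 0 ^+ 2 - 1) / c.
  by rewrite -(detM s Js); field.
by congr mat2; field.
Qed.

End Backlund.

(** * Transforms of null curves *)

Section Transforms.
Variables (R : realType) (J : set R).
Hypothesis J_open : open J.
Implicit Types (gam gamt F G : R -> 'M[R]_2) (q f : R -> R) (xi tau : R).

Lemma derive1_cousin q F s : hill_frame J q F -> J s ->
  derive1 (cousin F) s = col 1 (F s).
Proof.
move=> Fq Js; apply: is_derive1E; apply/is_derive_mxP => i j.
have h := (is_derive_mxP _ _ _ _).1 (Fq s Js).2 i 0.
have -> : (fun x => cousin F x i j) = (fun x => F x i 0).
  by apply/funext => x; rewrite mxE.
apply: is_derive_eq h _; rewrite [in LHS](mat2_eta (F s)) mul_mat2.
rewrite (mat2_eta (F s)) !mxE; case: ifP => _ /=; ring.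
Qed.

Lemma star_shaped_cousin q F : smooth_on J F -> hill_frame J q F ->
  star_shaped J (cousin F).
Proof.
move=> /smooth_onP Fs Fq; split.
- apply/smooth_onP => n; apply/diff_on_mxP => // i j.
  have := (diff_on_mxP J_open n F).1 (Fs n) i 0.
  by apply: diff_on_eq => // s _; rewrite mxE.
- move=> s Js; apply/negP => /eqP e0.
  have /eqP := (Fq s Js).1; rewrite det_mx22.
  have -> : F s 0 0 = 0 by have /matrixP/(_ 0 0) := e0; rewrite !mxE.
  have -> : F s 1 0 = 0 by have /matrixP/(_ 1 0) := e0; rewrite !mxE.
  by rewrite mul0r mulr0 subr0 eq_sym oner_eq0.
- move=> s Js; rewrite (derive1_cousin Fq Js) det2_cols.
  by rewrite -(Fq s Js).1 det_mx22.
Qed.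

Lemma spinor_star gam Fp Fm : spinor_frame J gam Fp Fm ->
  star_shaped J (cousin Fp) /\ star_shaped J (cousin Fm).
Proof.
move=> h; have [hp hm] := spinor_hill h; split.
  exact: star_shaped_cousin (spinor_smooth_p h) hp.
exact: star_shaped_cousin (spinor_smooth_m h) hm.
Qed.

(** A transform for chi = 0 is defined with some spinor frame along gam; this
    carries the formula over to any given one. *)
Lemma transform_curve_frame_indep gam Fp Fm Gp Gm xi f s :
  spinor_frame J gam Fp Fm -> spinor_frame J gam Gp Gm -> J s ->
  transform_curve Fp Fm xi f s = transform_curve Gp Gm xi f s.
Proof.
move=> hF hG Js; have [Fp1 Fm1] := spinor_hill hF; have [Gp1 Gm1] := spinor_hill hG.
rewrite /transform_curve !invmx_det1 ?(Fm1 s Js).1 ?(Gm1 s Js).1//.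
rewrite (frames_upper J_open Fp1 Fm1 (fun s => spinor_curve_adj hF (s := s)))//.
by rewrite (frames_upper J_open Gp1 Gm1 (fun s => spinor_curve_adj hG (s := s))).
Qed.

Lemma spinor_frame_of_hill k gam Fp Fm :
  smooth_on J Fp -> smooth_on J Fm ->
  hill_frame J (fun s => k s + 1) Fp -> hill_frame J (fun s => k s - 1) Fm ->
  (forall s, J s -> gam s = Fp s *m \adj (Fm s)) ->
  spinor_frame J gam Fp Fm.
Proof.
move=> sp sm hp hm gamE; split=> // s Js.
- exact: (hp s Js).1.
- exact: (hm s Js).1.
- by rewrite gamE// invmx_det1// (hm s Js).1.
- by rewrite (bending_frames J_open hp hm gamE Js); exact: is_derive1E (hp s Js).2.
- by rewrite (bending_frames J_open hp hm gamE Js); exact: is_derive1E (hm s Js).2.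
Qed.

Lemma smooth_backlund c f F : smooth_on J f -> smooth_on J F ->
  smooth_on J (fun s => F s *m backlund c (f s)).
Proof.
move=> /smooth_onP fs /smooth_onP Fs; apply/smooth_onP => n.
have cst a : diff_on J n (fun=> a : R) by exact: diff_on_cst.
apply: (diff_on_mulmx J_open (Fs n)).
have h0 : diff_on J n (fun s => - (c * f s)).
  apply: (diff_on_eq J_open (f := fun s => - c * f s)) => [s _|]; first by rewrite mulNr.
  exact: (diff_on_mul J_open (f := fun=> - c)).
have h1 : diff_on J n (fun s => c * f s ^+ 2 - c^-1).
  apply: (diff_onD J_open (f := fun s => c * f s ^+ 2) (g := fun=> - c^-1) _ (cst _)).
  apply: (diff_on_mul J_open (f := fun=> c) (g := fun s => f s ^+ 2) (cst c)).
  apply: (diff_on_eq J_open (f := fun s => f s * f s)) => [s _|].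
    by rewrite expr2.
  exact: (diff_on_mul J_open (fs n) (fs n)).
exact: (diff_on_mat2 J_open h0 h1 (cst c) h0).
Qed.

Lemma hill_frame_eq q q' F : (forall s, J s -> q s = q' s) ->
  hill_frame J q F -> hill_frame J q' F.
Proof. by move=> e h s Js; rewrite -e//; exact: h. Qed.

Section FromRiccati.
Variables (gam gamt Fp Fm : R -> 'M[R]_2) (xi tau : R) (f : R -> R).
Hypotheses (hF : spinor_frame J gam Fp Fm) (xi0 : xi != 0) (tau1 : tau ^+ 2 = 1)
  (hf : riccati_solution J (bending gam) xi f)
  (gamtE : forall s, J s -> gamt s = tau *: transform_curve Fp Fm xi f s).

Let ap := amplitude_p xi.
Let am := amplitude_m tau xi.
Let Gp := fun s => Fp s *m backlund ap (f s).
Let Gm := fun s => Fm s *m backlund am (f s).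
Let kt := fun s => - bending gam s + 2 * f s ^+ 2 - 2 * cosh (2 * xi).

Let tau0 : tau != 0.
Proof. by rewrite -sqrf_eq0 tau1 oner_neq0. Qed.

Let ap0 : ap != 0. Proof. exact: amplitude_p_neq0. Qed.
Let am0 : am != 0. Proof. exact: amplitude_m_neq0. Qed.

Let f_deriv s : J s -> is_derive s 1 f (bending gam s + cosh (2 * xi) - f s ^+ 2).
Proof.
move=> Js; have [fd e] := hf Js; rewrite -e addrK derive1E; exact: derivableP.
Qed.

Lemma transform_hill_p : hill_frame J (fun s => kt s + 1) Gp.
Proof.
have [hp _] := spinor_hill hF.
have fd s : J s -> is_derive s 1 f (bending gam s + 1 + ap ^- 2 - f s ^+ 2).
  by move=> Js; apply: is_derive_eq (f_deriv Js) _; rewrite amplitude_p_sqr; ring.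
apply: hill_frame_eq (hill_backlund ap0 hp fd) => s Js.
by rewrite amplitude_p_sqr /kt; ring.
Qed.

Lemma transform_hill_m : hill_frame J (fun s => kt s - 1) Gm.
Proof.
have [_ hm] := spinor_hill hF.
have fd s : J s -> is_derive s 1 f (bending gam s - 1 + am ^- 2 - f s ^+ 2).
  by move=> Js; apply: is_derive_eq (f_deriv Js) _; rewrite amplitude_m_sqr//; ring.
apply: hill_frame_eq (hill_backlund am0 hm fd) => s Js.
by rewrite amplitude_m_sqr// /kt; ring.
Qed.

Lemma transform_frames s : J s -> gamt s = Gp s *m \adj (Gm s).
Proof.
move=> Js; rewrite gamtE// /transform_curve invmx_det1; last first.
  exact: spinor_det_m hF s Js.
rewrite adjugate_mulmx2 !mulmxA -[Gp s *m _]mulmxA backlund_hyperbolic//.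
by rewrite -scalemxAr -scalemxAl.
Qed.

Lemma transform_bending s : J s -> bending gamt s = kt s.
Proof.
exact: (bending_frames J_open transform_hill_p transform_hill_m transform_frames).
Qed.

Lemma transform_T_chi0 : smooth_on J gam -> T_transform_chi0 J gam gamt.
Proof.
move=> gs; have [hp hm] := spinor_hill hF.
have fs : smooth_on J f.
  apply: (smooth_riccati J_open (q := fun s => bending gam s + cosh (2 * xi))).
    apply/smooth_onP => n; apply: (diff_onD J_open).
      exact: ((smooth_onP _ _).1 (smooth_bending J_open gs) n).
    exact: diff_on_cst.
  exact: f_deriv.
have hG : spinor_frame J gamt Gp Gm.
  apply: (spinor_frame_of_hill _ _ transform_hill_p transform_hill_m).
  - exact: smooth_backlund fs (spinor_smooth_p hF).
  - exact: smooth_backlund fs (spinor_smooth_m hF).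
  - exact: transform_frames.
have Mp s : J s -> \adj (Fp s) *m Gp s = backlund ap (f s).
  by move=> Js; rewrite mulmxA mul_adj_mx (hp s Js).1 mul1mx.
have Mm s : J s -> \adj (Fm s) *m Gm s = backlund am (f s).
  by move=> Js; rewrite mulmxA mul_adj_mx (hm s Js).1 mul1mx.
have [sFp sFm] := spinor_star hF; have [sGp sGm] := spinor_star hG.
exists Fp, Fm, Gp, Gm; split=> //.
  split; split=> //.
    by exists ap => // s Js; rewrite det2_col00 Mp// mxE.
  by exists am => // s Js; rewrite det2_col00 Mm// mxE.
move=> s Js.
rewrite (derive1_cousin transform_hill_p Js) (derive1_cousin transform_hill_m Js).
by rewrite !det2_col00 !det2_col01 Mp// Mm// !mxE/=; ring.
Qed.

End FromRiccati.

(** The base point s0 is where the two Riccati equations are compared, which gives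
    the relation between the constants a and b. *)
Lemma T_chi0_transform gam gamt Fp Fm s0 : J s0 ->
  spinor_frame J gam Fp Fm -> T_transform_chi0 J gam gamt ->
  exists xi tau f, [/\ xi != 0, riccati_solution J (bending gam) xi f,
    tau ^+ 2 = 1 &
    forall s, J s -> gamt s = tau *: transform_curve Fp Fm xi f s].
Proof.
move=> Js0 hF [Hp [Hm [Gp [Gm [hH hG [[_ _ [a a0 aE]] [_ _ [b b0 bE]]] chi0]]]]].
have [hp hm] := spinor_hill hH; have [gp gm] := spinor_hill hG.
have [f fP] : exists f : R -> R, forall s, J s ->
    is_derive s 1 f (bending gam s + 1 + a ^- 2 - f s ^+ 2) /\
    Gp s = Hp s *m backlund a (f s).
  by apply: (backlund_of_hill J_open a0 hp gp) => s Js; rewrite -det2_col00 aE.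
have [g gP] : exists f : R -> R, forall s, J s ->
    is_derive s 1 f (bending gam s - 1 + b ^- 2 - f s ^+ 2) /\
    Gm s = Hm s *m backlund b (f s).
  by apply: (backlund_of_hill J_open b0 hm gm) => s Js; rewrite -det2_col00 bE.
(* The condition chi = 0 reads a b (f - g) = 0. *)
have gf s : J s -> g s = f s.
  move=> Js; have := chi0 s Js.
  rewrite (derive1_cousin gp Js) (derive1_cousin gm Js) aE// bE// !det2_col01.
  have [_ ->] := fP s Js; have [_ ->] := gP s Js.
  rewrite !mulmxA !mul_adj_mx (hp s Js).1 (hm s Js).1 !mul1mx !mxE/= => e.
  apply: (mulfI (mulf_neq0 a0 b0)); apply/eqP; rewrite -subr_eq0; apply/eqP.
  by rewrite -[RHS]oppr0 -e; ring.
have ab : b ^- 2 - a ^- 2 = 2.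
  have [fd _] := fP s0 Js0; have [gd _] := gP s0 Js0.
  have := is_derive1E (is_derive_on J_open gf Js0 gd).
  rewrite (is_derive1E fd) gf//; lra.
have r0 := sqrt2_neq0 R; have r2 := sqrt2_sqr R; set r := Num.sqrt 2 in r0 r2.
have r_gt0 : 0 < r by rewrite sqrtr_gt0.
(* The hyperbolic cosine has to be positive, so the sign of b is split off and
   becomes the overall sign tau. *)
have [xi [sE cE]] : exists xi, sinh xi = (r * a)^-1 /\ cosh xi = (r * `|b|)^-1.
  apply: hyperbola_param; first by rewrite invr_gt0 mulr_gt0// normr_gt0.
  rewrite !exprVn !exprMn r2 real_normK ?num_real//.
  transitivity (2^-1 * (b ^- 2 - a ^- 2)); first by field; rewrite a0 b0.
  by rewrite ab mulVf.
have xi0 : xi != 0 by rewrite -sinh_eq0 sE invr_neq0// mulf_neq0.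
pose tau := Num.sg b.
have tau1 : tau ^+ 2 = 1 by rewrite sqr_sg b0.
have apE : amplitude_p xi = a by rewrite /amplitude_p sE -/r; field; rewrite a0.
have amE : amplitude_m tau xi = b.
  rewrite /amplitude_m cE -/r [RHS]numEsg -/tau; field.
  by rewrite r0 normr_eq0 b0.
have cosh2 : cosh (2 * xi) = 1 + a ^- 2.
  by rewrite -apE amplitude_p_sqr; ring.
exists xi, tau, f; split=> // s Js; have [fd Gpf] := fP s Js.
  by split; [case: fd|rewrite (is_derive1E fd) cosh2; ring].
rewrite (transform_curve_frame_indep _ _ hF hH Js) (spinor_curve_adj hG Js) Gpf.
have [_ ->] := gP s Js; rewrite gf// -{1}apE -amE /transform_curve.
rewrite (invmx_det1 (hm s Js).1) adjugate_mulmx2 mulmxA -[Hp s *m _ *m _]mulmxA.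
by rewrite backlund_hyperbolic// -scalemxAr -scalemxAl.
Qed.

End Transforms.

Lemma eq_up_to_signP (R : realType) (J : set R) (gam gamt : R -> 'M[R]_2) :
  eq_up_to_sign_on J gam gamt <->
  exists2 tau : R, tau ^+ 2 = 1 & forall s, J s -> gamt s = tau *: gam s.
Proof.
split=> [[h|h]|[tau /eqP]].
- by exists 1 => [|s Js]; rewrite ?expr1n// scale1r h.
- by exists (-1) => [|s Js]; rewrite ?sqrrN ?expr1n// scaleN1r h.
rewrite sqrf_eq1 => /orP[] /eqP -> h; [left|right] => s Js.
- by rewrite h// scale1r.
- by rewrite h// scaleN1r.
Qed.

Theorem theorem3p8 (R : realType) (J : set R) (gam gamt : R -> 'M[R]_2)
    (Fp Fm : R -> 'M[R]_2) (hJ : open_interval J)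
    (hgam : null_curve J gam) (hF : spinor_frame J gam Fp Fm)
    (hgamt : null_curve J gamt) :
  (T_transform_chi0 J gam gamt <->
   exists (xi : R) (f : R -> R),
     [/\ xi != 0, riccati_solution J (bending gam) xi f &
         eq_up_to_sign_on J (transform_curve Fp Fm xi f) gamt]) /\
  (forall (xi : R) (f : R -> R),
     xi != 0 -> riccati_solution J (bending gam) xi f ->
     eq_up_to_sign_on J (transform_curve Fp Fm xi f) gamt ->
     forall s, J s ->
       bending gamt s = - bending gam s + 2 * f s ^+ 2 - 2 * cosh (2 * xi)).
Proof.
have [J_open _] := hJ; split; last first.
  move=> xi f xi0 hf /eq_up_to_signP[tau tau1 gamtE] s Js.
  exact: (transform_bending J_open hF xi0 tau1 hf gamtE Js).
split=> [hT|[xi [f [xi0 hf /eq_up_to_signP[tau tau1 gamtE]]]]]; last first.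
  exact: (transform_T_chi0 J_open hF xi0 tau1 hf gamtE (null_curve_smooth hgam)).
(* On an empty J every xi <> 0 and f will do. *)
have [[s0 Js0]|J0] := pselect (exists s, J s); last first.
  exists 1, (fun=> 0); split; first exact: oner_neq0.
    by move=> s Js; case: J0; exists s.
  by left=> s Js; case: J0; exists s.
have [xi [tau [f [xi0 hf tau1 gamtE]]]] := T_chi0_transform J_open Js0 hF hT.
by exists xi, f; split=> //; apply/eq_up_to_signP; exists tau.
Qed.
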